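(* Let $\mathcal{E}$ be an exact category and let $k \ge 0$ be an integer. Then the monomorphism category $\operatorname{MMor}_k(\mathcal{E})$, equipped with its class of admissible short exact sequences (the componentwise admissible ones), is an exact category.
   Context: Exact categories are in the sense of Quillen (as in Bühler's survey): an additive category $\mathcal{E}$ with a class $\mathcal{S}$ of kernel-cokernel pairs (closed under isomorphism), called admissible short exact sequences, whose kernels are called admissible monomorphisms and whose cokernels are called admissible epimorphisms, such that both classes contain identities and are closed under composition, pushouts of admissible monomorphisms along arbitrary morphisms exist and are admissible monomorphisms, and dually for pullbacks of admissible epimorphisms. For $k\ge 0$, $\operatorname{Mor}_k(\mathcal{E})$ is the category of functors from the poset $\{1<\cdots<k+1\}$ to $\mathcal{E}$; its objects are diagrams $(X_\bullet,f_\bullet)= X_1\xrightarrow{f_1}\cdots\xrightarrow{f_k}X_{k+1}$. It is an exact category in which $X_\bullet\to Y_\bullet\to Z_\bullet$ is admissible iff $X_i\to Y_i\to Z_i$ is an admissible short exact sequence in $\mathcal{E}$ for every $1\le i\le k+1$. $\operatorname{MMor}_k(\mathcal{E})$ is the full subcategory of $\operatorname{Mor}_k(\mathcal{E})$ of those objects $X_1\to\cdots\to X_{k+1}$ in which every map is an admissible monomorphism in $\mathcal{E}$. An admissible short exact sequence in $\operatorname{MMor}_k(\mathcal{E})$ is a sequence $X_\bullet\to Y_\bullet\to Z_\bullet$ of objects of $\operatorname{MMor}_k(\mathcal{E})$ that is admissible in $\operatorname{Mor}_k(\mathcal{E})$. *)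

(* Defs.v *)
From HB Require Import structures.
From mathcomp Require Import all_boot all_algebra boolp.

Set Implicit Arguments.
Unset Strict Implicit.
Unset Printing Implicit Defensive.

Import GRing.Theory.
Local Open Scope ring_scope.

Declare Scope cat_scope.
Delimit Scope cat_scope with cat.

(* A category enriched in abelian groups.  The choice structure that comes with
   [zmodType] is no restriction in the presence of the classical axioms of
   [boolp].  Equality of morphisms is Leibniz equality. *)
Record preadditive := Preadditive {
  obj :> Type;
  mor : obj -> obj -> zmodType;
  idm : forall X, mor X X;
  mcomp : forall X Y Z, mor Y Z -> mor X Y -> mor X Z;
  mcompA : forall X Y Z W (h : mor Z W) (g : mor Y Z) (f : mor X Y),
    mcomp h (mcomp g f) = mcomp (mcomp h g) f;
  mcomp1m : forall X Y (f : mor X Y), mcomp (idm Y) f = f;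
  mcompm1 : forall X Y (f : mor X Y), mcomp f (idm X) = f;
  mcompDl : forall X Y Z (g g' : mor Y Z) (f : mor X Y),
    mcomp (g + g') f = mcomp g f + mcomp g' f;
  mcompDr : forall X Y Z (g : mor Y Z) (f f' : mor X Y),
    mcomp g (f + f') = mcomp g f + mcomp g f' }.

Arguments mor {_} _ _.
Arguments idm {_} _.
Arguments mcomp {_ _ _ _} _ _.

Notation "g \oc f" := (mcomp g f)
  (at level 40, left associativity, format "g  \oc  f") : cat_scope.
Local Open Scope cat_scope.

Section Notions.
Variable C : preadditive.

Definition is_iso (X Y : C) (f : mor X Y) : Prop :=
  exists g : mor Y X, g \oc f = idm X /\ f \oc g = idm Y.

Definition is_zero_object (Z : C) : Prop :=
  forall X : C, (exists! f : mor Z X, True) /\ (exists! f : mor X Z, True).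

Definition is_biproduct (X Y P : C) (i1 : mor X P) (i2 : mor Y P)
    (p1 : mor P X) (p2 : mor P Y) : Prop :=
  [/\ p1 \oc i1 = idm X, p2 \oc i2 = idm Y, p1 \oc i2 = 0, p2 \oc i1 = 0 &
      i1 \oc p1 + i2 \oc p2 = idm P].

Definition is_additive : Prop :=
  (exists Z : C, is_zero_object Z) /\
  (forall X Y : C, exists (P : C) (i1 : mor X P) (i2 : mor Y P)
     (p1 : mor P X) (p2 : mor P Y), is_biproduct i1 i2 p1 p2).

Definition is_kernel (X Y Z : C) (i : mor X Y) (p : mor Y Z) : Prop :=
  p \oc i = 0 /\
  forall (W : C) (f : mor W Y), p \oc f = 0 -> exists! g : mor W X, i \oc g = f.

Definition is_cokernel (X Y Z : C) (i : mor X Y) (p : mor Y Z) : Prop :=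
  p \oc i = 0 /\
  forall (W : C) (f : mor Y W), f \oc i = 0 -> exists! g : mor Z W, g \oc p = f.

Definition is_kernel_cokernel_pair (X Y Z : C) (i : mor X Y) (p : mor Y Z) : Prop :=
  is_kernel i p /\ is_cokernel i p.

(* The square  i : A -> B,  f : A -> A',  f' : B -> B',  i' : A' -> B'. *)
Definition is_pushout (A B A' B' : C) (i : mor A B) (f : mor A A')
    (f' : mor B B') (i' : mor A' B') : Prop :=
  f' \oc i = i' \oc f /\
  forall (W : C) (u : mor B W) (v : mor A' W), u \oc i = v \oc f ->
    exists! w : mor B' W, w \oc f' = u /\ w \oc i' = v.

(* The square  p' : B' -> C',  f' : B' -> B,  f : C' -> D,  p : B -> D. *)
Definition is_pullback (B D B' C' : C) (p : mor B D) (f : mor C' D)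
    (f' : mor B' B) (p' : mor B' C') : Prop :=
  p \oc f' = f \oc p' /\
  forall (W : C) (u : mor W B) (v : mor W C'), p \oc u = f \oc v ->
    exists! w : mor W B', f' \oc w = u /\ p' \oc w = v.

Definition pair_class := forall X Y Z : C, mor X Y -> mor Y Z -> Prop.

Definition admissible_mono (S : pair_class) (X Y : C) (i : mor X Y) : Prop :=
  exists (Z : C) (p : mor Y Z), S X Y Z i p.

Definition admissible_epi (S : pair_class) (Y Z : C) (p : mor Y Z) : Prop :=
  exists (X : C) (i : mor X Y), S X Y Z i p.

Definition iso_closed (S : pair_class) : Prop :=
  forall (X Y Z X' Y' Z' : C) (i : mor X Y) (p : mor Y Z)
    (i' : mor X' Y') (p' : mor Y' Z')
    (a : mor X X') (b : mor Y Y') (c : mor Z Z'),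
    is_iso a -> is_iso b -> is_iso c ->
    b \oc i = i' \oc a -> c \oc p = p' \oc b ->
    S X Y Z i p -> S X' Y' Z' i' p'.

Record is_exact_category (S : pair_class) : Prop := IsExactCategory {
  exact_additive : is_additive;
  exact_kercoker : forall (X Y Z : C) (i : mor X Y) (p : mor Y Z),
    S X Y Z i p -> is_kernel_cokernel_pair i p;
  exact_iso : iso_closed S;
  exact_mono_id : forall X : C, admissible_mono S (idm X);
  exact_epi_id : forall X : C, admissible_epi S (idm X);
  exact_mono_comp : forall (X Y Z : C) (i : mor X Y) (j : mor Y Z),
    admissible_mono S i -> admissible_mono S j -> admissible_mono S (j \oc i);
  exact_epi_comp : forall (X Y Z : C) (p : mor X Y) (q : mor Y Z),
    admissible_epi S p -> admissible_epi S q -> admissible_epi S (q \oc p);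
  exact_pushout : forall (A B A' : C) (i : mor A B) (f : mor A A'),
    admissible_mono S i ->
    exists (B' : C) (f' : mor B B') (i' : mor A' B'),
      is_pushout i f f' i' /\ admissible_mono S i';
  exact_pullback : forall (B D C' : C) (p : mor B D) (f : mor C' D),
    admissible_epi S p ->
    exists (B' : C) (f' : mor B' B) (p' : mor B' C'),
      is_pullback p f f' p' /\ admissible_epi S p' }.

End Notions.

Section FullSubcategory.
Variables (C : preadditive) (P : C -> Prop).

Definition full_subcategory : preadditive :=
  @Preadditive {X : C | P X} (fun X Y => mor (sval X) (sval Y))
    (fun X => idm (sval X)) (fun X Y Z g f => g \oc f)
    (fun X Y Z W h g f => mcompA h g f)
    (fun X Y f => mcomp1m f) (fun X Y f => mcompm1 f)
    (fun X Y Z g g' f => mcompDl g g' f) (fun X Y Z g f f' => mcompDr g f f').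

End FullSubcategory.

Section Mor.
Variables (E : preadditive) (k : nat).

(* Functors to E from the poset {1 < ... < k+1}, represented by the ordinals
   {0 < ... < k} of ['I_k.+1]. *)
Record diagram := Diagram {
  dobj :> 'I_k.+1 -> E;
  dmap : forall i j : 'I_k.+1, (i <= j)%N -> mor (dobj i) (dobj j);
  dmap_id : forall (i : 'I_k.+1) (h : (i <= i)%N), dmap h = idm (dobj i);
  dmap_comp : forall (i j l : 'I_k.+1)
      (hij : (i <= j)%N) (hjl : (j <= l)%N) (hil : (i <= l)%N),
    dmap hil = dmap hjl \oc dmap hij }.

Record dhom (X Y : diagram) := DHom {
  dcomp :> forall i : 'I_k.+1, mor (X i) (Y i);
  dnat : forall (i j : 'I_k.+1) (h : (i <= j)%N),
    dcomp j \oc dmap X h = dmap Y h \oc dcomp i }.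

Lemma dhom_eq (X Y : diagram) (f g : dhom X Y) : (forall i, f i = g i) -> f = g.
Proof.
case: f g => [f hf] [g hg] /= e.
have {}e : f = g by apply: functional_extensionality_dep.
by subst g; congr DHom; apply: Prop_irrelevance.
Qed.

Lemma mcomp0m (X Y Z : E) (f : mor X Y) : (0 : mor Y Z) \oc f = 0.
Proof. by apply: (addrI ((0 : mor Y Z) \oc f)); rewrite -mcompDl !addr0. Qed.

Lemma mcompm0 (X Y Z : E) (f : mor Y Z) : f \oc (0 : mor X Y) = 0.
Proof. by apply: (addrI (f \oc (0 : mor X Y))); rewrite -mcompDr !addr0. Qed.

Lemma mcompNm (X Y Z : E) (g : mor Y Z) (f : mor X Y) : (- g) \oc f = - (g \oc f).
Proof. by apply: (addrI (g \oc f)); rewrite -mcompDl !subrr mcomp0m. Qed.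

Lemma mcompmN (X Y Z : E) (g : mor Y Z) (f : mor X Y) : g \oc (- f) = - (g \oc f).
Proof. by apply: (addrI (g \oc f)); rewrite -mcompDr !subrr mcompm0. Qed.

Section DHomZmodule.
Variables X Y : diagram.

Lemma dzero_subproof (i j : 'I_k.+1) (h : (i <= j)%N) :
  (0 : mor (X j) (Y j)) \oc dmap X h = dmap Y h \oc 0.
Proof. by rewrite mcomp0m mcompm0. Qed.

Definition dzero : dhom X Y := DHom dzero_subproof.

Lemma dopp_subproof (f : dhom X Y) (i j : 'I_k.+1) (h : (i <= j)%N) :
  (- f j) \oc dmap X h = dmap Y h \oc (- f i).
Proof. by rewrite mcompNm mcompmN dnat. Qed.

Definition dopp (f : dhom X Y) : dhom X Y := DHom (dopp_subproof f).

Lemma dadd_subproof (f g : dhom X Y) (i j : 'I_k.+1) (h : (i <= j)%N) :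
  (f j + g j) \oc dmap X h = dmap Y h \oc (f i + g i).
Proof. by rewrite mcompDl mcompDr !dnat. Qed.

Definition dadd (f g : dhom X Y) : dhom X Y := DHom (dadd_subproof f g).

Lemma daddA : associative dadd.
Proof. by move=> f g h; apply: dhom_eq => i /=; rewrite addrA. Qed.

Lemma daddC : commutative dadd.
Proof. by move=> f g; apply: dhom_eq => i /=; rewrite addrC. Qed.

Lemma dadd0 : left_id dzero dadd.
Proof. by move=> f; apply: dhom_eq => i /=; rewrite add0r. Qed.

Lemma daddN : left_inverse dzero dopp dadd.
Proof. by move=> f; apply: dhom_eq => i /=; rewrite addNr. Qed.

HB.instance Definition _ := gen_eqMixin (dhom X Y).
HB.instance Definition _ := gen_choiceMixin (dhom X Y).
HB.instance Definition _ := GRing.isZmodule.Build (dhom X Y) daddA daddC dadd0 daddN.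

End DHomZmodule.

Lemma did_subproof (X : diagram) (i j : 'I_k.+1) (h : (i <= j)%N) :
  idm (X j) \oc dmap X h = dmap X h \oc idm (X i).
Proof. by rewrite mcomp1m mcompm1. Qed.

Definition did (X : diagram) : dhom X X := DHom (@did_subproof X).

Lemma dcompose_subproof (X Y Z : diagram) (g : dhom Y Z) (f : dhom X Y)
    (i j : 'I_k.+1) (h : (i <= j)%N) :
  (g j \oc f j) \oc dmap X h = dmap Z h \oc (g i \oc f i).
Proof. by rewrite -mcompA dnat mcompA dnat mcompA. Qed.

Definition dcompose (X Y Z : diagram) (g : dhom Y Z) (f : dhom X Y) : dhom X Z :=
  DHom (dcompose_subproof g f).

Lemma dcomposeA (X Y Z W : diagram) (h : dhom Z W) (g : dhom Y Z) (f : dhom X Y) :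
  dcompose h (dcompose g f) = dcompose (dcompose h g) f.
Proof. by apply: dhom_eq => i; apply: mcompA. Qed.

Lemma dcompose1m (X Y : diagram) (f : dhom X Y) : dcompose (did Y) f = f.
Proof. by apply: dhom_eq => i; apply: mcomp1m. Qed.

Lemma dcomposem1 (X Y : diagram) (f : dhom X Y) : dcompose f (did X) = f.
Proof. by apply: dhom_eq => i; apply: mcompm1. Qed.

Lemma dcomposeDl (X Y Z : diagram) (g g' : dhom Y Z) (f : dhom X Y) :
  dcompose (g + g') f = dcompose g f + dcompose g' f.
Proof. by apply: dhom_eq => i; apply: mcompDl. Qed.

Lemma dcomposeDr (X Y Z : diagram) (g : dhom Y Z) (f f' : dhom X Y) :
  dcompose g (f + f') = dcompose g f + dcompose g f'.
Proof. by apply: dhom_eq => i; apply: mcompDr. Qed.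

Definition Mor : preadditive :=
  @Preadditive diagram (fun X Y => dhom X Y : zmodType) did dcompose
    dcomposeA dcompose1m dcomposem1 dcomposeDl dcomposeDr.

Variable S : pair_class E.

Definition Mor_admissible : pair_class Mor :=
  fun (X Y Z : diagram) (f : dhom X Y) (g : dhom Y Z) =>
    forall i : 'I_k.+1, @S (X i) (Y i) (Z i) (f i) (g i).

Definition is_mono_diagram (X : diagram) : Prop :=
  forall (i j : 'I_k.+1) (h : (i <= j)%N),
    j = i.+1 :> nat -> admissible_mono S (dmap X h).

Definition MMor : preadditive := @full_subcategory Mor is_mono_diagram.

Definition MMor_admissible : pair_class MMor :=
  fun X Y Z (f : mor X Y) (g : mor Y Z) =>
    @Mor_admissible (sval X) (sval Y) (sval Z) f g.

End Mor.

(* Main.v *)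
From mathcomp Require Import all_boot all_algebra boolp.
Require Import Defs.

Set Implicit Arguments.
Unset Strict Implicit.
Unset Printing Implicit Defensive.

Import GRing.Theory.
Local Open Scope ring_scope.
Local Open Scope cat_scope.

(** Diagrams of shape [1 < ... < k+1] with the componentwise structure form an
    exact category: kernels, cokernels, pushouts and pullbacks of diagrams are
    formed componentwise, the transition maps being induced by the universal
    properties ([Mor_exact]).  A full subcategory of an exact category that
    contains a zero object and is closed under extensions inherits an exact
    structure ([extension_closed_exact]).  Indeed a biproduct is an extension
    of its summands, a pushout of an admissible monomorphism is an extension
    of the same cokernel ([pushout_exact]), the cokernel of a composite of
    admissible monomorphisms is an extension of the two cokernels
    ([exact_noether]), and the other closure properties are dual.

    It remains to see that the diagrams of admissible monomorphisms are closed
    under extensions among all diagrams.  Each transition map of an extension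
    is the middle map of a morphism of admissible short exact sequences whose
    outer maps are admissible monomorphisms, so this is the five lemma for
    admissible monomorphisms ([five_admissible_mono]), which rests on the short
    five lemma ([short_five]). *)

(** * Duality *)

Section Opposite.
Variable C : preadditive.

(** The opposite category.  Kernels and cokernels, pullbacks and pushouts are
    exchanged definitionally, so that the dual of a lemma is its instance at
    the opposite category. *)
Definition opposite : preadditive :=
  @Preadditive C (fun X Y => mor Y X) (fun X => idm X)
    (fun X Y Z g f => f \oc g)
    (fun X Y Z W h g f => esym (mcompA f g h))
    (fun X Y f => mcompm1 f) (fun X Y f => mcomp1m f)
    (fun X Y Z g g' f => mcompDr f g g') (fun X Y Z g f f' => mcompDl f f' g).

(** The reversed pairs; admissible monomorphisms and admissible epimorphisms
    are exchanged definitionally. *)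
Definition opposite_class (S : pair_class C) : pair_class opposite :=
  fun X Y Z i p => S Z Y X p i.

Lemma opposite_iso (X Y : C) (f : mor X Y) :
  @is_iso opposite Y X f -> is_iso f.
Proof. by case=> g [gf fg]; exists g. Qed.

Lemma opposite_exact (S : pair_class C) :
  is_exact_category S -> is_exact_category (opposite_class S).
Proof.
move=> [[[Z hZ] bip] kc isoS mid eid mcmp ecmp po pb]; split.
- split; first by exists Z => X; case: (hZ X).
  move=> X Y; have [P [i1 [i2 [p1 [p2 [h1 h2 h3 h4 h5]]]]]] := bip X Y.
  by exists P, p1, p2, i1, i2; split.
- by move=> X Y Z' i p /kc [].
- move=> X Y Z' X' Y' Z'' i p i' p' a b c.
  move=> /opposite_iso [a' [aa1 aa2]] /opposite_iso [b' [bb1 bb2]].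
  move=> /opposite_iso [c' [cc1 cc2]] hi hp.
  have {}hi : @mcomp C _ _ _ i b = @mcomp C _ _ _ a i' := hi.
  have {}hp : @mcomp C _ _ _ p c = @mcomp C _ _ _ b p' := hp.
  apply: (isoS _ _ _ _ _ _ _ _ _ _ c' b' a').
  + by exists c.
  + by exists b.
  + by exists a.
  + by rewrite -[LHS]mcompm1 -cc2 !mcompA -(mcompA b') hp mcompA bb1 mcomp1m.
  + by rewrite -[LHS]mcompm1 -bb2 !mcompA -(mcompA a') hi mcompA aa1 mcomp1m.
- exact: eid.
- exact: mid.
- by move=> X Y Z' i j hi hj; apply: ecmp.
- by move=> X Y Z' i j hi hj; apply: mcmp.
- by move=> A B A' i f hi; apply: pb.
- by move=> B D C' p f hp; apply: po.
Qed.

End Opposite.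

(** * Kernels, cokernels and zero objects *)

Section Universal.
Variable C : preadditive.
Implicit Types A B D K P Q W X Y Z : C.

Lemma kernel_mono X Y Z (i : mor X Y) (p : mor Y Z) : is_kernel i p ->
  forall W (g g' : mor W X), i \oc g = i \oc g' -> g = g'.
Proof.
move=> [pi0 univ] W g g' e.
have [|h [_ hu]] := univ W (i \oc g); first by rewrite mcompA pi0 mcomp0m.
by rewrite -(hu g erefl) -(hu g' (esym e)).
Qed.

Lemma kernel_factor X Y Z (i : mor X Y) (p : mor Y Z) : is_kernel i p ->
  forall W (f : mor W Y), p \oc f = 0 -> exists g, i \oc g = f.
Proof. by move=> [_ univ] W f /univ [g [eg _]]; exists g. Qed.

Lemma is_kernel_of_mono X Y Z (i : mor X Y) (p : mor Y Z) :
  p \oc i = 0 ->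
  (forall W (g g' : mor W X), i \oc g = i \oc g' -> g = g') ->
  (forall W (f : mor W Y), p \oc f = 0 -> exists g, i \oc g = f) ->
  is_kernel i p.
Proof.
move=> pi0 mono fac; split=> // W f /fac [g eg].
by exists g; split=> // g' eg'; apply: mono; rewrite eg eg'.
Qed.

Lemma kernel_unique X X' Y Z (i : mor X Y) (i' : mor X' Y) (p : mor Y Z) :
  is_kernel i p -> is_kernel i' p -> exists2 w, is_iso w & i' \oc w = i.
Proof.
move=> ki ki'; have [w ew] := kernel_factor ki' (proj1 ki).
have [v ev] := kernel_factor ki (proj1 ki').
exists w => //; exists v; split.
  by apply: (kernel_mono ki); rewrite mcompA ev ew mcompm1.
by apply: (kernel_mono ki'); rewrite mcompA ew ev mcompm1.
Qed.

Lemma pushout_epi A B A' B' (i : mor A B) (f : mor A A') (f' : mor B B')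
    (i' : mor A' B') : is_pushout i f f' i' ->
  forall W (g g' : mor B' W), g \oc f' = g' \oc f' -> g \oc i' = g' \oc i' ->
  g = g'.
Proof.
move=> [sq univ] W g g' ef ei.
have [|h [_ hu]] := univ W (g \oc f') (g \oc i'); first by rewrite -!mcompA sq.
by rewrite -(hu g) // -(hu g') // ef ei.
Qed.

Lemma pushout_factor A B A' B' (i : mor A B) (f : mor A A') (f' : mor B B')
    (i' : mor A' B') : is_pushout i f f' i' ->
  forall W (u : mor B W) (v : mor A' W), u \oc i = v \oc f ->
  exists w, w \oc f' = u /\ w \oc i' = v.
Proof. by move=> [_ univ] W u v /univ [w [ew _]]; exists w. Qed.

Lemma is_pushout_sym A B A' B' (i : mor A B) (f : mor A A') (f' : mor B B')
    (i' : mor A' B') : is_pushout i f f' i' -> is_pushout f i i' f'.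
Proof.
move=> po; split=> [|W u v e]; first by rewrite (proj1 po).
have [w [ew1 ew2]] := pushout_factor po (esym e).
exists w; split=> // w' [ew1' ew2'].
by apply: (pushout_epi po); rewrite ?ew1 ?ew2 ?ew1' ?ew2'.
Qed.

Lemma pushout_unique A B A' B' B'' (i : mor A B) (f : mor A A')
    (f' : mor B B') (i' : mor A' B') (f'' : mor B B'') (i'' : mor A' B'') :
  is_pushout i f f' i' -> is_pushout i f f'' i'' ->
  exists2 w, is_iso w & w \oc i' = i''.
Proof.
move=> po' po''.
have [w [ew1 ew2]] := pushout_factor po' (proj1 po'').
have [v [ev1 ev2]] := pushout_factor po'' (proj1 po').
exists w => //; exists v; split.
  by apply: (pushout_epi po'); rewrite -mcompA ?ew1 ?ew2 ?ev1 ?ev2 mcomp1m.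
by apply: (pushout_epi po''); rewrite -mcompA ?ev1 ?ev2 ?ew1 ?ew2 mcomp1m.
Qed.

Lemma zero_id X : is_zero_object X -> idm X = 0.
Proof.
by case/(_ X) => [[f [_ fu]] _]; rewrite -(fu (idm X) I) -(fu 0 I).
Qed.

Lemma zero_of_id X : idm X = 0 -> is_zero_object X.
Proof.
move=> e Y; split; exists 0; split=> // f _.
  by rewrite -[f]mcompm1 e mcompm0.
by rewrite -[f]mcomp1m e mcomp0m.
Qed.

Lemma zero_iso X Y : idm X = 0 -> idm Y = 0 -> is_iso (0 : mor X Y).
Proof. by move=> eX eY; exists 0; rewrite !mcompm0 eX eY. Qed.

Lemma id_iso X : is_iso (idm X).
Proof. by exists (idm X); rewrite mcomp1m. Qed.

End Universal.

Section UniversalDual.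
Variable C : preadditive.
Implicit Types A B D K P Q W X Y Z : C.

Lemma cokernel_epi X Y Z (i : mor X Y) (p : mor Y Z) : is_cokernel i p ->
  forall W (g g' : mor Z W), g \oc p = g' \oc p -> g = g'.
Proof. exact: (@kernel_mono (opposite C) Z Y X p i). Qed.

Lemma cokernel_factor X Y Z (i : mor X Y) (p : mor Y Z) : is_cokernel i p ->
  forall W (f : mor Y W), f \oc i = 0 -> exists g, g \oc p = f.
Proof. exact: (@kernel_factor (opposite C) Z Y X p i). Qed.

Lemma is_cokernel_of_epi X Y Z (i : mor X Y) (p : mor Y Z) :
  p \oc i = 0 ->
  (forall W (g g' : mor Z W), g \oc p = g' \oc p -> g = g') ->
  (forall W (f : mor Y W), f \oc i = 0 -> exists g, g \oc p = f) ->
  is_cokernel i p.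
Proof. exact: (@is_kernel_of_mono (opposite C) Z Y X p i). Qed.

Lemma pullback_mono B D B' D' (p : mor B D) (f : mor D' D) (f' : mor B' B)
    (p' : mor B' D') : is_pullback p f f' p' ->
  forall W (g g' : mor W B'), f' \oc g = f' \oc g' -> p' \oc g = p' \oc g' ->
  g = g'.
Proof. exact: (@pushout_epi (opposite C) D B D' B' p f f' p'). Qed.

Lemma pullback_factor B D B' D' (p : mor B D) (f : mor D' D) (f' : mor B' B)
    (p' : mor B' D') : is_pullback p f f' p' ->
  forall W (u : mor W B) (v : mor W D'), p \oc u = f \oc v ->
  exists w, f' \oc w = u /\ p' \oc w = v.
Proof. exact: (@pushout_factor (opposite C) D B D' B' p f f' p'). Qed.

End UniversalDual.

(** * Exact categories *)

Section ExactCategory.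
Variables (C : preadditive) (S : pair_class C).
Hypothesis hS : is_exact_category S.
Implicit Types A B D K P Q W X Y Z : C.

Lemma exact_kernel X Y Z (i : mor X Y) (p : mor Y Z) :
  S i p -> is_kernel i p.
Proof. by case/(exact_kercoker hS). Qed.

Lemma exact_cokernel X Y Z (i : mor X Y) (p : mor Y Z) :
  S i p -> is_cokernel i p.
Proof. by case/(exact_kercoker hS). Qed.

Lemma exact_change_kernel X X' Y Z (i : mor X Y) (i' : mor X' Y)
    (p : mor Y Z) : S i p -> is_kernel i' p -> S i' p.
Proof.
move=> Sip ki'; have [w isow ew] := kernel_unique (exact_kernel Sip) ki'.
apply: (exact_iso hS isow (id_iso Y) (id_iso Z) _ _ Sip).
  by rewrite mcomp1m ew.
by rewrite mcomp1m mcompm1.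
Qed.

End ExactCategory.

Lemma exact_change_cokernel (C : preadditive) (S : pair_class C)
    (hS : is_exact_category S) (X Y Z Z' : C) (i : mor X Y) (p : mor Y Z)
    (p' : mor Y Z') : S X Y Z i p -> is_cokernel i p' -> S X Y Z' i p'.
Proof. exact: (exact_change_kernel (opposite_exact hS)). Qed.

Section ExactCategoryTheory.
Variables (C : preadditive) (S : pair_class C).
Hypothesis hS : is_exact_category S.
Implicit Types A B D K P Q W X Y Z : C.

Lemma exact_id_zero X Z : idm Z = 0 -> S (idm X) (0 : mor X Z).
Proof.
move=> eZ; have [Y [p Sp]] := exact_mono_id hS X.
apply: (exact_change_cokernel hS Sp); apply: is_cokernel_of_epi.
- by rewrite mcomp0m.
- by move=> W g g' _; rewrite -[g]mcompm1 -[g']mcompm1 eZ !mcompm0.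
- by move=> W f; rewrite mcompm1 => ->; exists 0; rewrite mcomp0m.
Qed.

Lemma admissible_mono_iso X Y (w : mor X Y) : is_iso w -> admissible_mono S w.
Proof.
move=> isow; have [[Z /zero_id eZ] _] := exact_additive hS.
exists Z, 0; apply: (exact_iso hS (id_iso X) isow (id_iso Z) _ _ (exact_id_zero X eZ)).
  by [].
by rewrite mcomp0m mcompm0.
Qed.

(** Stated for every pushout of an admissible monomorphism, not only for the
    one provided by the axioms. *)
Lemma pushout_admissible_mono A B A' B' (i : mor A B) (f : mor A A')
    (f' : mor B B') (i' : mor A' B') :
  is_pushout i f f' i' -> admissible_mono S i -> admissible_mono S i'.
Proof.
move=> po /(exact_pushout hS f) [B'' [f'' [i'' [po'' mi'']]]].
have [w isow <-] := pushout_unique po'' po.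
by apply: (exact_mono_comp hS mi''); apply: admissible_mono_iso.
Qed.

(** A pushout along an admissible monomorphism has the same cokernel. *)
Lemma pushout_exact A B A' B' Z (i : mor A B) (p : mor B Z) (f : mor A A')
    (f' : mor B B') (i' : mor A' B') : S i p -> is_pushout i f f' i' ->
  exists2 p' : mor B' Z, S i' p' & p' \oc f' = p.
Proof.
move=> Sip po; have cp := exact_cokernel hS Sip.
have [Z' [q Sq]] : admissible_mono S i'.
  by apply: (pushout_admissible_mono po); exists Z, p.
have [|p' [p'f p'i]] := @pushout_factor _ _ _ _ _ _ _ _ _ po Z p 0.
  by rewrite mcomp0m (proj1 cp).
exists p' => //; apply: (exact_change_cokernel hS Sq).
apply: is_cokernel_of_epi => // [W g g' e|W g gi'].
  by apply: (cokernel_epi cp); rewrite -p'f !mcompA e.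
have [|h hp] := cokernel_factor cp (f := g \oc f').
  by rewrite -mcompA (proj1 po) mcompA gi' mcomp0m.
exists h; apply: (pushout_epi po); rewrite -mcompA.
  by rewrite p'f hp.
by rewrite p'i mcompm0 gi'.
Qed.

Lemma exists_pushout_exact A B A' Z (i : mor A B) (p : mor B Z) (f : mor A A') :
  S i p -> exists (B' : C) (f' : mor B B') (i' : mor A' B') (p' : mor B' Z),
    [/\ is_pushout i f f' i', S i' p' & p' \oc f' = p].
Proof.
move=> Sip; have mi : admissible_mono S i by exists Z, p.
have [B' [f' [i' [po _]]]] := exact_pushout hS f mi.
by have [p' Sp' e] := pushout_exact Sip po; exists B', f', i', p'.
Qed.

(** Noether isomorphism: the cokernel of a composite [j \oc i] of admissible
    monomorphisms, obtained as the pushout of [j] along the cokernel of [i],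
    is an extension of the cokernel of [j] by the cokernel of [i]. *)
Lemma exact_noether X Y Z P Q (i : mor X Y) (p : mor Y P) (j : mor Y Z)
    (q : mor Z Q) : S i p -> S j q ->
  exists (R : C) (r : mor Z R) (m : mor P R) (n : mor R Q),
    S (j \oc i) r /\ S m n.
Proof.
move=> Sip Sjq; have cp := exact_cokernel hS Sip.
have [R [r [m [n [po Smn _]]]]] := exists_pushout_exact p Sjq.
exists R, r, m, n; split=> //.
have [||Z' [z Sz]] := exact_mono_comp hS (i := i) (j := j).
- by exists P, p.
- by exists Q, q.
apply: (exact_change_cokernel hS Sz).
have rj W g (h : mor R W) : h \oc r = g -> (h \oc m) \oc p = g \oc j.
  by move=> <-; rewrite -!mcompA (proj1 po).
apply: is_cokernel_of_epi => [|W g g' e|W g].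
- by rewrite mcompA (proj1 po) -mcompA (proj1 cp) mcompm0.
- apply: (pushout_epi po) => //.
  by apply: (cokernel_epi cp); rewrite (rj _ _ _ e) (rj _ _ _ erefl).
- rewrite mcompA => /(cokernel_factor cp) [h hp].
  by have [w [wr _]] := pushout_factor po (esym hp); exists w.
Qed.

(** A biproduct is the pushout of its two summands over a zero object, so its
    canonical sequence is admissible. *)
Lemma biproduct_exact X Y P (i1 : mor X P) (i2 : mor Y P) (p1 : mor P X)
    (p2 : mor P Y) : is_biproduct i1 i2 p1 p2 -> S i1 p2.
Proof.
move=> [e11 e22 e12 e21 eP].
have [K [i Si]] := exact_epi_id hS Y.
have i0 : i = 0 by have := proj1 (exact_kernel hS Si); rewrite mcomp1m.
(* [K] is a zero object, the kernel of the identity of [Y]. *)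
have po : is_pushout i (0 : mor K X) i2 i1.
  split=> [|W u v _]; first by rewrite i0 !mcompm0.
  exists (v \oc p1 + u \oc p2); split=> [|w [<- <-]].
    rewrite !mcompDl -!mcompA e11 e22 e12 e21.
    by rewrite !mcompm0 !mcompm1 add0r addr0.
  by rewrite -!mcompA -mcompDr eP mcompm1.
have [q Sq qi2] := pushout_exact Si po.
suff -> : p2 = q by [].
have cq := exact_cokernel hS Sq.
by rewrite -[q]mcompm1 -eP mcompDr !mcompA (proj1 cq) mcomp0m add0r qi2 mcomp1m.
Qed.

End ExactCategoryTheory.

Section ExactCategoryDual.
Variables (C : preadditive) (S : pair_class C).
Hypothesis hS : is_exact_category S.
Implicit Types A B D K P Q W X Y Z : C.

Lemma exact_zero_id X Z : idm Z = 0 -> S (0 : mor Z X) (idm X).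
Proof. exact: (exact_id_zero (opposite_exact hS)). Qed.

Lemma pullback_admissible_epi B D B' D' (p : mor B D) (f : mor D' D)
    (f' : mor B' B) (p' : mor B' D') :
  is_pullback p f f' p' -> admissible_epi S p -> admissible_epi S p'.
Proof. exact: (pushout_admissible_mono (opposite_exact hS)). Qed.

Lemma exists_pullback_exact K B D D' (i : mor K B) (p : mor B D)
    (f : mor D' D) : S i p ->
  exists (B' : C) (f' : mor B' B) (p' : mor B' D') (i' : mor K B'),
    [/\ is_pullback p f f' p', S i' p' & f' \oc i' = i].
Proof. exact: (exists_pushout_exact (opposite_exact hS) f). Qed.

Lemma exact_noether_epi X Y Z P Q (i : mor P X) (p : mor X Y) (j : mor Q Y)
    (q : mor Y Z) : S i p -> S j q ->
  exists (R : C) (r : mor R X) (m : mor P R) (n : mor R Q),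
    S r (q \oc p) /\ S m n.
Proof.
move=> Sip Sjq.
have [R [r [n [m [Sr Snm]]]]] := exact_noether (opposite_exact hS) Sjq Sip.
by exists R, r, m, n.
Qed.

(** Short five lemma: a morphism of admissible short exact sequences that is
    the identity at both ends is an isomorphism.  On the fibre product of [B]
    and [B'] over [Z], the second projection [v] lifts through [h] as [w], and
    [w] vanishes on the kernel of [v], hence factors through [v]; this gives a
    right inverse of the monomorphism [h]. *)
Lemma short_five A B B' Z (i : mor A B) (p : mor B Z) (i' : mor A B')
    (p' : mor B' Z) (h : mor B B') :
  S i p -> S i' p' -> h \oc i = i' -> p' \oc h = p -> is_iso h.
Proof.
move=> Sip Sip' hi ph.
have [P [u [v [n [pb Snv un]]]]] := exists_pullback_exact p' Sip.
have ki := exact_kernel hS Sip; have ki' := exact_kernel hS Sip'.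
have cv := exact_cokernel hS Snv.
have hmono W (x : mor W B) : h \oc x = 0 -> x = 0.
  move=> hx; have [|y iy] := kernel_factor ki (f := x).
    by rewrite -ph -mcompA hx mcompm0.
  rewrite -iy (_ : y = 0) ?mcompm0 //; apply: (kernel_mono ki').
  by rewrite mcompm0 -hi -mcompA iy.
have [|k ik] := kernel_factor ki' (f := v - h \oc u).
  by rewrite mcompDr mcompmN mcompA ph (proj1 pb) subrr.
pose w := u + i \oc k.
have hw : h \oc w = v by rewrite mcompDr mcompA hi ik addrC subrK.
have [|g gv] := cokernel_factor cv (f := w).
  by apply: hmono; rewrite mcompA hw (proj1 cv).
have hg : h \oc g = idm B'.
  by apply: (cokernel_epi cv); rewrite -mcompA gv hw mcomp1m.
exists g; split=> //; apply/eqP; rewrite -subr_eq0; apply/eqP/hmono.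
by rewrite mcompDr mcompmN mcompA hg mcomp1m mcompm1 subrr.
Qed.

(** The pullback of an admissible monomorphism along an admissible epimorphism
    is the kernel of an admissible epimorphism. *)
Lemma pullback_admissible_mono B D B' D' (p : mor B D) (c : mor D' D)
    (m : mor B' B) (q : mor B' D') : is_pullback p c m q ->
  admissible_epi S p -> admissible_mono S c -> admissible_mono S m.
Proof.
move=> pb ep [Q [e Sce]]; have kc := exact_kernel hS Sce.
have [|K [x Sx]] := exact_epi_comp hS ep (q := e); first by exists D', c.
exists Q, (e \oc p); apply: (exact_change_kernel hS Sx).
apply: is_kernel_of_mono => [|W g g' eg|W g].
- by rewrite -mcompA (proj1 pb) mcompA (proj1 kc) mcomp0m.
- apply: (pullback_mono pb) => //; apply: (kernel_mono kc).
  by rewrite !mcompA -(proj1 pb) -!mcompA eg.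
- rewrite -mcompA => /(kernel_factor kc) [y cy].
  by have [w [mw _]] := pullback_factor pb (esym cy); exists w.
Qed.

(** Five lemma for admissible monomorphisms.  The middle map factors as the
    pushout [b1] of [a], followed by an isomorphism (the short five lemma),
    followed by the pullback [b2] of [c]. *)
Lemma five_admissible_mono A B Z A' B' Z' (i : mor A B) (p : mor B Z)
    (i' : mor A' B') (p' : mor B' Z') (a : mor A A') (b : mor B B')
    (c : mor Z Z') :
  S i p -> S i' p' -> b \oc i = i' \oc a -> c \oc p = p' \oc b ->
  admissible_mono S a -> admissible_mono S c -> admissible_mono S b.
Proof.
move=> Sip Sip' bi cp ma mc; have cokp := exact_cokernel hS Sip.
have [D [b1 [i1 [p1 [po S1 p1b1]]]]] := exists_pushout_exact hS a Sip.
have [D' [b2 [p2 [i2 [pb S2 b2i2]]]]] := exists_pullback_exact c Sip'.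
have [d [b2d p2d]] := pullback_factor pb (esym cp).
have di : d \oc i = i2 \oc a.
  apply: (pullback_mono pb); rewrite !mcompA.
    by rewrite b2d b2i2.
  by rewrite p2d (proj1 cokp) (proj1 (exact_kernel hS S2)) mcomp0m.
have [h [hb1 hi1]] := pushout_factor po di.
have isoh : is_iso h.
  apply: (short_five S1 S2 hi1); apply: (pushout_epi po); rewrite -mcompA.
    by rewrite hb1 p2d p1b1.
  by rewrite hi1 (proj1 (exact_kernel hS S2)) (proj1 (exact_kernel hS S1)).
rewrite -b2d -hb1; apply: (exact_mono_comp hS).
  apply: (exact_mono_comp hS).
    exact: (pushout_admissible_mono hS (is_pushout_sym po) ma).
  exact: admissible_mono_iso.
by apply: (pullback_admissible_mono pb) => //; exists A', i'.
Qed.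

End ExactCategoryDual.

(** * Extension-closed subcategories *)

Section ExtensionClosed.
Variables (C : preadditive) (S : pair_class C) (P : C -> Prop).

(** Closure of the objects satisfying [P] under extensions, that is, under the
    middle terms of pairs in [S]. *)
Definition extension_closed : Prop :=
  forall (X Y Z : C) (i : mor X Y) (p : mor Y Z),
    S i p -> P X -> P Z -> P Y.

(** The pairs of the full subcategory on [P] that lie in [S]; in particular all
    three objects of such a pair satisfy [P]. *)
Definition full_class : pair_class (full_subcategory P) :=
  fun X Y Z (i : mor X Y) (p : mor Y Z) => @S (sval X) (sval Y) (sval Z) i p.

(** Each object required by the axioms (biproduct, pushout, pullback, cokernel
    or kernel of a composite) is an extension of objects satisfying [P]. *)
Lemma extension_closed_exact :
  is_exact_category S -> extension_closed ->
  (exists2 Z : C, is_zero_object Z & P Z) -> is_exact_category full_class.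
Proof.
move=> hS extP [O zO PO]; have eO := zero_id zO.
pose O' : full_subcategory P := exist P O PO.
split.
- split; first by exists O' => X; apply: (zO (sval X)).
  move=> [X PX] [Y PY].
  have [Q [i1 [i2 [p1 [p2 bip]]]]] := proj2 (exact_additive hS) X Y.
  have PQ : P Q by apply: (extP _ _ _ _ _ (biproduct_exact hS bip)).
  by exists (exist P Q PQ), i1, i2, p1, p2; case: bip => *; split.
- move=> X Y Z i p /(exact_kercoker hS) [[pi0 ki] [_ cp]].
  by split; split=> // W; [apply: ki|apply: cp].
- move=> X Y Z X' Y' Z' i p i' p' a b c [a' aK] [b' bK] [c' cK] bi cp Sip.
  by apply: (exact_iso hS (a := a) (b := b) (c := c)) Sip => //;
    [exists a'|exists b'|exists c'].
- by move=> X; exists O', 0; apply: (exact_id_zero hS).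
- by move=> X; exists O', 0; apply: (exact_zero_id hS).
- move=> X Y Z i j [P1 [p Sp]] [P2 [q Sq]].
  have [R [r [m [n [Sr Smn]]]]] := exact_noether hS Sp Sq.
  have PR : P R by apply: (extP _ _ _ _ _ Smn); apply: svalP.
  by exists (exist P R PR), r.
- move=> X Y Z p q [P1 [i Si]] [P2 [j Sj]].
  have [R [r [m [n [Sr Smn]]]]] := exact_noether_epi hS Si Sj.
  have PR : P R by apply: (extP _ _ _ _ _ Smn); apply: svalP.
  by exists (exist P R PR), r.
- move=> A B A' i f [Z [p Sp]].
  have [B' [f' [i' [p' [[sq po] Sp' _]]]]] := exists_pushout_exact hS f Sp.
  have PB : P B' by apply: (extP _ _ _ _ _ Sp'); apply: svalP.
  exists (exist P B' PB), f', i'; split; last by exists Z, p'.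
  by split=> // W; apply: po.
- move=> B D D' p f [K [i Si]].
  have [B' [f' [p' [i' [[sq pb] Sp' _]]]]] := exists_pullback_exact hS f Si.
  have PB : P B' by apply: (extP _ _ _ _ _ Sp'); apply: svalP.
  exists (exist P B' PB), f', p'; split; last by exists K, i'.
  by split=> // W; apply: pb.
Qed.

End ExtensionClosed.

(** * Diagrams *)

Lemma dependent_choice_fun (I : Type) (T : I -> Type)
    (R : forall i, T i -> Prop) :
  (forall i, exists y, R i y) -> exists f : forall i, T i, forall i, R i (f i).
Proof. by move=> h; exists (fun i => sval (cid (h i))) => i; case: cid. Qed.

Section Diagrams.
Variables (E : preadditive) (k : nat).

(** Maps characterised uniquely by a relation that holds for identities and is
    stable under composition assemble into a diagram. *)
Lemma diagram_of_unique (Z : 'I_k.+1 -> E)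
    (R : forall i j : 'I_k.+1, (i <= j)%N -> mor (Z i) (Z j) -> Prop) :
  (forall i j h, exists! z, R i j h z) ->
  (forall i h, R i i h (idm (Z i))) ->
  (forall i j l hij hjl hil (z : mor (Z i) (Z j)) (z' : mor (Z j) (Z l)),
     R i j hij z -> R j l hjl z' -> R i l hil (z' \oc z)) ->
  exists d : forall i j : 'I_k.+1, (i <= j)%N -> mor (Z i) (Z j),
    [/\ forall i h, d i i h = idm (Z i),
        forall i j l hij hjl hil, d i l hil = d j l hjl \oc d i j hij &
        forall i j h, R i j h (d i j h)].
Proof.
move=> ex1 Rid Rcomp; pose d i j h := sval (cid (ex1 i j h)).
have dP i j h : unique (R i j h) (d i j h) by rewrite /d; case: cid.
exists d; split=> [i h|i j l hij hjl hil|i j h].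
- by rewrite ((dP i i h).2 _ (Rid i h)).
- by rewrite ((dP i l hil).2 _ (Rcomp _ _ _ _ _ _ _ _ (dP i j hij).1 (dP j l hjl).1)).
- exact: (dP i j h).1.
Qed.

Implicit Types X Y Z W A B D : Mor E k.

Lemma Mor_is_kernel X Y Z (f : dhom X Y) (g : dhom Y Z) :
  (forall i, is_kernel (f i) (g i)) -> @is_kernel (Mor E k) X Y Z f g.
Proof.
move=> ker; apply: is_kernel_of_mono => [|W u v e|W h gh].
- by apply: dhom_eq => i; apply: (proj1 (ker i)).
- apply: dhom_eq => i; apply: (kernel_mono (ker i)).
  exact: (congr1 (fun w : dhom W Y => w i) e).
- have [|w fw] := @dependent_choice_fun _ _ (fun i w => f i \oc w = h i).
    move=> i; apply: (kernel_factor (ker i)).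
    exact: (congr1 (fun w : dhom W Z => w i) gh).
  have nat_w (i j : 'I_k.+1) (hij : (i <= j)%N) : w j \oc dmap W hij = dmap X hij \oc w i.
    apply: (kernel_mono (ker j)).
    by rewrite !mcompA fw dnat dnat -mcompA fw.
  by exists (DHom nat_w); apply: dhom_eq.
Qed.

Lemma Mor_is_cokernel X Y Z (f : dhom X Y) (g : dhom Y Z) :
  (forall i, is_cokernel (f i) (g i)) -> @is_cokernel (Mor E k) X Y Z f g.
Proof.
move=> cok; apply: is_cokernel_of_epi => [|W u v e|W h hf].
- by apply: dhom_eq => i; apply: (proj1 (cok i)).
- apply: dhom_eq => i; apply: (cokernel_epi (cok i)).
  exact: (congr1 (fun w : dhom Y W => w i) e).
- have [|w wg] := @dependent_choice_fun _ _ (fun i w => w \oc g i = h i).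
    move=> i; apply: (cokernel_factor (cok i)).
    exact: (congr1 (fun w : dhom X W => w i) hf).
  have nat_w (i j : 'I_k.+1) (hij : (i <= j)%N) : w j \oc dmap Z hij = dmap W hij \oc w i.
    apply: (cokernel_epi (cok i)).
    by rewrite -!mcompA wg -dnat mcompA wg dnat.
  by exists (DHom nat_w); apply: dhom_eq.
Qed.

Lemma Mor_is_pushout A B A' B' (u : dhom A B) (f : dhom A A') (f' : dhom B B')
    (u' : dhom A' B') : (forall i, is_pushout (u i) (f i) (f' i) (u' i)) ->
  @is_pushout (Mor E k) A B A' B' u f f' u'.
Proof.
move=> po; split=> [|W x y e].
  by apply: dhom_eq => i; apply: (proj1 (po i)).
have [|w wP] := @dependent_choice_fun _ _
    (fun i w => w \oc f' i = x i /\ w \oc u' i = y i).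
  move=> i; apply: (pushout_factor (po i)).
  exact: (congr1 (fun w : dhom A W => w i) e).
have nat_w (i j : 'I_k.+1) (hij : (i <= j)%N) : w j \oc dmap B' hij = dmap W hij \oc w i.
  have [wi1 wi2] := wP i; have [wj1 wj2] := wP j.
  apply: (pushout_epi (po i)); rewrite -!mcompA -dnat.
    by rewrite wi1 mcompA wj1 dnat.
  by rewrite wi2 mcompA wj2 dnat.
exists (DHom nat_w); split=> [|v [vx vy]].
  by split; apply: dhom_eq => i; case: (wP i).
apply: dhom_eq => i; have [wi1 wi2] := wP i.
apply: (pushout_epi (po i)); rewrite /= ?wi1 ?wi2.
  exact: (congr1 (fun w : dhom B W => w i) (esym vx)).
exact: (congr1 (fun w : dhom A' W => w i) (esym vy)).
Qed.

Lemma Mor_is_pullback B D B' D' (p : dhom B D) (f : dhom D' D)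
    (f' : dhom B' B) (p' : dhom B' D') :
  (forall i, is_pullback (p i) (f i) (f' i) (p' i)) ->
  @is_pullback (Mor E k) B D B' D' p f f' p'.
Proof.
move=> pb; split=> [|W x y e].
  by apply: dhom_eq => i; apply: (proj1 (pb i)).
have [|w wP] := @dependent_choice_fun _ _
    (fun i w => f' i \oc w = x i /\ p' i \oc w = y i).
  move=> i; apply: (pullback_factor (pb i)).
  exact: (congr1 (fun w : dhom W D => w i) e).
have nat_w (i j : 'I_k.+1) (hij : (i <= j)%N) : w j \oc dmap W hij = dmap B' hij \oc w i.
  have [wi1 wi2] := wP i; have [wj1 wj2] := wP j.
  apply: (pullback_mono (pb j)); rewrite !mcompA dnat.
    by rewrite wj1 -mcompA wi1 dnat.
  by rewrite wj2 -mcompA wi2 dnat.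
exists (DHom nat_w); split=> [|v [vx vy]].
  by split; apply: dhom_eq => i; case: (wP i).
apply: dhom_eq => i; have [wi1 wi2] := wP i.
apply: (pullback_mono (pb i)); rewrite /= ?wi1 ?wi2.
  exact: (congr1 (fun w : dhom W B => w i) (esym vx)).
exact: (congr1 (fun w : dhom W D' => w i) (esym vy)).
Qed.

Lemma Mor_exists_pushout A B A' (u : dhom A B) (f : dhom A A') :
  (forall i, exists (B' : E) (f' : mor (B i) B') (u' : mor (A' i) B'),
     is_pushout (u i) (f i) f' u') ->
  exists (B' : Mor E k) (f' : dhom B B') (u' : dhom A' B'),
    forall i, is_pushout (u i) (f i) (f' i) (u' i).
Proof.
move=> /dependent_choice_fun [B' /dependent_choice_fun [f']].
move=> /dependent_choice_fun [u' po].
have [i j h|i h|i j l hij hjl hil z z' [z1 z2] [z1' z2']|d [did dcomp dP]] :=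
    @diagram_of_unique B' (fun i j h z =>
      z \oc f' i = f' j \oc dmap B h /\ z \oc u' i = u' j \oc dmap A' h).
- apply: (proj2 (po i)).
  by rewrite -!mcompA -!dnat !mcompA (proj1 (po j)).
- by rewrite !dmap_id !mcomp1m !mcompm1.
- by rewrite (dmap_comp B hij hjl) (dmap_comp A' hij hjl) -!mcompA z1 z2
    !mcompA z1' z2'.
have nat_f' (i j : 'I_k.+1) (h : (i <= j)%N) : f' j \oc dmap B h = d i j h \oc f' i by case: (dP i j h).
have nat_u' (i j : 'I_k.+1) (h : (i <= j)%N) : u' j \oc dmap A' h = d i j h \oc u' i by case: (dP i j h).
exists (Diagram did dcomp).
by exists (@DHom _ _ B (Diagram did dcomp) f' nat_f'),
  (@DHom _ _ A' (Diagram did dcomp) u' nat_u').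
Qed.

Lemma Mor_exists_pullback B D D' (p : dhom B D) (f : dhom D' D) :
  (forall i, exists (B' : E) (f' : mor B' (B i)) (p' : mor B' (D' i)),
     is_pullback (p i) (f i) f' p') ->
  exists (B' : Mor E k) (f' : dhom B' B) (p' : dhom B' D'),
    forall i, is_pullback (p i) (f i) (f' i) (p' i).
Proof.
move=> /dependent_choice_fun [B' /dependent_choice_fun [f']].
move=> /dependent_choice_fun [p' pb].
have [i j h|i h|i j l hij hjl hil z z' [z1 z2] [z1' z2']|d [did dcomp dP]] :=
    @diagram_of_unique B' (fun i j h z =>
      f' j \oc z = dmap B h \oc f' i /\ p' j \oc z = dmap D' h \oc p' i).
- apply: (proj2 (pb j)).
  by rewrite !mcompA !dnat -!mcompA (proj1 (pb i)).
- by rewrite !dmap_id !mcomp1m !mcompm1.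
- by rewrite (dmap_comp B hij hjl) (dmap_comp D' hij hjl) !mcompA z1' z2'
    -!mcompA z1 z2.
have nat_f' (i j : 'I_k.+1) (h : (i <= j)%N) : f' j \oc d i j h = dmap B h \oc f' i by case: (dP i j h).
have nat_p' (i j : 'I_k.+1) (h : (i <= j)%N) : p' j \oc d i j h = dmap D' h \oc p' i by case: (dP i j h).
exists (Diagram did dcomp).
by exists (@DHom _ _ (Diagram did dcomp) B f' nat_f'),
  (@DHom _ _ (Diagram did dcomp) D' p' nat_p').
Qed.

(** The constant diagram on a zero object. *)
Lemma Mor_exists_zero : (exists Z : E, is_zero_object Z) ->
  exists Z : Mor E k, is_zero_object Z /\ forall i, idm (Z i) = 0.
Proof.
move=> [Z /zero_id eZ].
have dcomp (i j l : 'I_k.+1) (hij : (i <= j)%N) (hjl : (j <= l)%N)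
  (hil : (i <= l)%N) : idm Z = idm Z \oc idm Z by rewrite mcomp1m.
exists (@Diagram E k (fun=> Z) (fun _ _ _ => idm Z) (fun _ _ => erefl) dcomp).
by split=> //; apply: zero_of_id; apply: dhom_eq.
Qed.

(** The transition maps are determined by compatibility with the inclusions;
    their compatibility with the projections follows. *)
Lemma Mor_exists_biproduct X Y :
  (forall i, exists (P : E) (i1 : mor (X i) P) (i2 : mor (Y i) P)
     (p1 : mor P (X i)) (p2 : mor P (Y i)), is_biproduct i1 i2 p1 p2) ->
  exists (P : Mor E k) (i1 : mor X P) (i2 : mor Y P)
     (p1 : mor P X) (p2 : mor P Y), is_biproduct i1 i2 p1 p2.
Proof.
move=> /dependent_choice_fun [P /dependent_choice_fun [i1]].
move=> /dependent_choice_fun [i2 /dependent_choice_fun [p1]].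
move=> /dependent_choice_fun [p2 bip].
have [i j h|i h|i j l hij hjl hil z z' [z1 z2] [z1' z2']|d [did dcomp dP]] :=
    @diagram_of_unique P (fun i j h z =>
      z \oc i1 i = i1 j \oc dmap X h /\ z \oc i2 i = i2 j \oc dmap Y h).
- have [e11 e22 e12 e21 eP] := bip i.
  exists (i1 j \oc dmap X h \oc p1 i + i2 j \oc dmap Y h \oc p2 i).
  split=> [|z [z1 z2]].
    by rewrite !mcompDl -!mcompA e11 e22 e12 e21 !mcompm0 !mcompm1 add0r addr0.
  by rewrite -z1 -z2 -!mcompA -mcompDr eP mcompm1.
- by rewrite !dmap_id !mcomp1m !mcompm1.
- by rewrite (dmap_comp X hij hjl) (dmap_comp Y hij hjl) -!mcompA z1 z2
    !mcompA z1' z2'.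
pose Q := Diagram did dcomp.
have nat_i1 (i j : 'I_k.+1) (h : (i <= j)%N) : i1 j \oc dmap X h = dmap Q h \oc i1 i by case: (dP i j h).
have nat_i2 (i j : 'I_k.+1) (h : (i <= j)%N) : i2 j \oc dmap Y h = dmap Q h \oc i2 i by case: (dP i j h).
have split_d (i j : 'I_k.+1) (h : (i <= j)%N) :
    d i j h = i1 j \oc dmap X h \oc p1 i + i2 j \oc dmap Y h \oc p2 i.
  have [<- <-] := dP i j h; have [_ _ _ _ eP] := bip i.
  by rewrite -!mcompA -mcompDr eP mcompm1.
have nat_p1 (i j : 'I_k.+1) (h : (i <= j)%N) : p1 j \oc dmap Q h = dmap X h \oc p1 i.
  have [e11 e22 e12 e21 eP] := bip j.
  by rewrite /= split_d mcompDr !mcompA e11 e12 mcomp1m !mcomp0m addr0.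
have nat_p2 (i j : 'I_k.+1) (h : (i <= j)%N) : p2 j \oc dmap Q h = dmap Y h \oc p2 i.
  have [e11 e22 e12 e21 eP] := bip j.
  by rewrite /= split_d mcompDr !mcompA e22 e21 mcomp1m !mcomp0m add0r.
exists Q, (@DHom _ _ X Q i1 nat_i1), (@DHom _ _ Y Q i2 nat_i2),
  (@DHom _ _ Q X p1 nat_p1), (@DHom _ _ Q Y p2 nat_p2).
by split; apply: dhom_eq => i; case: (bip i).
Qed.

Variable S : pair_class E.
Hypothesis hE : is_exact_category S.

(** A componentwise admissible monomorphism has a componentwise cokernel. *)
Lemma Mor_admissible_mono X Y (f : dhom X Y) :
  (forall i, admissible_mono S (f i)) ->
  @admissible_mono (Mor E k) (@Mor_admissible E k S) X Y f.
Proof.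
move=> /dependent_choice_fun [Z /dependent_choice_fun [p Sp]].
have cp i := exact_cokernel hE (Sp i).
have [i j h|i h|i j l hij hjl hil z z' zP zP'|d [did dcomp dP]] :=
    @diagram_of_unique Z (fun i j h z => z \oc p i = p j \oc dmap Y h).
- apply: (proj2 (cp i)).
  by rewrite -mcompA -dnat mcompA (proj1 (cp j)) mcomp0m.
- by rewrite dmap_id mcomp1m mcompm1.
- by rewrite (dmap_comp Y hij hjl) -mcompA zP !mcompA zP'.
have nat_p (i j : 'I_k.+1) (h : (i <= j)%N) : p j \oc dmap Y h = d i j h \oc p i by rewrite dP.
exists (Diagram did dcomp).
by exists (@DHom _ _ Y (Diagram did dcomp) p nat_p).
Qed.

(** A componentwise admissible epimorphism has a componentwise kernel. *)
Lemma Mor_admissible_epi Y Z (g : dhom Y Z) :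
  (forall i, admissible_epi S (g i)) ->
  @admissible_epi (Mor E k) (@Mor_admissible E k S) Y Z g.
Proof.
move=> /dependent_choice_fun [X /dependent_choice_fun [u Su]].
have ku i := exact_kernel hE (Su i).
have [i j h|i h|i j l hij hjl hil z z' zP zP'|d [did dcomp dP]] :=
    @diagram_of_unique X (fun i j h z => u j \oc z = dmap Y h \oc u i).
- apply: (proj2 (ku j)).
  by rewrite mcompA dnat -mcompA (proj1 (ku i)) mcompm0.
- by rewrite dmap_id mcomp1m mcompm1.
- by rewrite (dmap_comp Y hij hjl) mcompA zP' -!mcompA zP.
have nat_u (i j : 'I_k.+1) (h : (i <= j)%N) : u j \oc d i j h = dmap Y h \oc u i by rewrite dP.
exists (Diagram did dcomp).
by exists (@DHom _ _ (Diagram did dcomp) Y u nat_u).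
Qed.

Lemma Mor_iso X Y (f : dhom X Y) :
  @is_iso (Mor E k) X Y f -> forall i, is_iso (f i).
Proof.
move=> [g [gf fg]] i; exists ((g : dhom Y X) i); split.
  exact: (congr1 (fun w : dhom X X => w i) gf).
exact: (congr1 (fun w : dhom Y Y => w i) fg).
Qed.

(** The category of diagrams, with the componentwise structure, is exact. *)
Lemma Mor_exact : is_exact_category (@Mor_admissible E k S).
Proof.
split.
- split.
    have [Z [zZ _]] := Mor_exists_zero (proj1 (exact_additive hE)).
    by exists Z.
  move=> X Y; apply: Mor_exists_biproduct => i.
  exact: (proj2 (exact_additive hE)).
- move=> X Y Z f g Sfg; split.
    by apply: Mor_is_kernel => i; apply: (exact_kernel hE).
  by apply: Mor_is_cokernel => i; apply: (exact_cokernel hE).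
- move=> X Y Z X' Y' Z' u p u' p' a b c.
  move=> /Mor_iso isoa /Mor_iso isob /Mor_iso isoc bu cp Sup i.
  apply: (exact_iso hE (isoa i) (isob i) (isoc i) _ _ (Sup i)).
    exact: (congr1 (fun w : dhom X Y' => w i) bu).
  exact: (congr1 (fun w : dhom Y Z' => w i) cp).
- by move=> X; apply: Mor_admissible_mono => i; apply: (exact_mono_id hE).
- by move=> X; apply: Mor_admissible_epi => i; apply: (exact_epi_id hE).
- move=> X Y Z u v [P [p Sp]] [Q [q Sq]]; apply: Mor_admissible_mono => i.
  by apply: (exact_mono_comp hE); [exists (P i), (p i)|exists (Q i), (q i)].
- move=> X Y Z p q [P [u Su]] [Q [v Sv]]; apply: Mor_admissible_epi => i.
  by apply: (exact_epi_comp hE); [exists (P i), (u i)|exists (Q i), (v i)].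
- move=> A B A' u f [Z [p Sp]].
  have mu i : admissible_mono S ((u : dhom A B) i) by exists (Z i), (p i).
  have [i|B' [f' [u' po]]] := @Mor_exists_pushout A B A' u f.
    by have [B' [f' [u' [po _]]]] := exact_pushout hE ((f : dhom A A') i) (mu i);
      exists B', f', u'.
  exists B', f', u'; split; first exact: Mor_is_pushout.
  by apply: Mor_admissible_mono => i; apply: (pushout_admissible_mono hE (po i)).
- move=> B D D' p f [K [u Su]].
  have ep i : admissible_epi S ((p : dhom B D) i) by exists (K i), (u i).
  have [i|B' [f' [p' pb]]] := @Mor_exists_pullback B D D' p f.
    by have [B' [f' [p' [pb _]]]] := exact_pullback hE ((f : dhom D' D) i) (ep i);
      exists B', f', p'.
  exists B', f', p'; split; first exact: Mor_is_pullback.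
  by apply: Mor_admissible_epi => i; apply: (pullback_admissible_epi hE (pb i)).
Qed.

(** * Monomorphism diagrams *)

Lemma mono_diagram_extension_closed :
  extension_closed (@Mor_admissible E k S) (@is_mono_diagram E k S).
Proof.
move=> X Y Z f g Sfg mX mZ i j h eij.
exact: (five_admissible_mono hE (Sfg i) (Sfg j) (esym (dnat f h))
  (esym (dnat g h)) (mX i j h eij) (mZ i j h eij)).
Qed.

End Diagrams.

Theorem proposition3p5 (E : preadditive) (S : pair_class E)
    (hE : is_exact_category S) (k : nat) :
  is_exact_category (@MMor_admissible E k S).
Proof.
apply: (extension_closed_exact (Mor_exact k hE)).
  exact: mono_diagram_extension_closed.
have [Z [zZ eZ]] := Mor_exists_zero k (proj1 (exact_additive hE)).
(* All maps of the zero diagram vanish and are isomorphisms. *)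
exists Z => // i j h _; apply: (admissible_mono_iso hE).
have isoZ : is_iso (0 : mor (Z i) (Z j)) by apply: zero_iso.
by rewrite -[dmap Z h]mcompm1 eZ mcompm0.
Qed.
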